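(* Let $A,B,a$ be independent variables and let $G\mapsto[G]$ be a function assigning to each 4-valent graph diagram $G$ an element of $\mathbb{Q}(A,B,a)$. Suppose that it satisfies the graphical calculus, i.e. identities (G1)–(G4) of the context, and that the skein relation $$[\text{crossing}]=A\,[\text{A-smoothing}]+B\,[\text{B-smoothing}]+[\text{vertex}]$$ holds at every crossing, where the four diagrams are identical except that the crossing is replaced by its A-smoothing, its B-smoothing, or a vertex. Then $[\,\cdot\,]$ is invariant under regular isotopies of 4-valent rigid vertex embedded graphs, and it satisfies $$[\text{strand with a positive curl}]=a\,[\text{strand}],\qquad [\text{strand with a negative curl}]=a^{-1}\,[\text{strand}].$$
   Context: A 4-valent graph diagram is a nonempty diagram in the plane, up to planar isotopy, of a 4-valent graph embedded in three-space, with finitely many vertices and finitely many crossings (with over/under information). Loops, multiple edges, several components, and components that are closed curves without vertices are allowed. Regular isotopy of 4-valent rigid vertex embedded graphs is the equivalence relation on diagrams generated by planar isotopy and the moves: (II) and (III) the second and third Reidemeister moves; (IV) moving a strand over, or under, a vertex; (V) rotating a rigid vertex by a half turn, i.e. a vertex is replaced by the vertex with a crossing of two cyclically adjacent half-edges on one side and the opposite (inverse half twist) crossing of the other two half-edges on the other side. Smoothings: at a crossing of an unoriented diagram, orient the two strands locally so that the crossing is positive (standard sign convention). The A-smoothing is the smoothing compatible with these local orientations, and the B-smoothing is the other planar smoothing. A curl is a kink in a strand with a single crossing, bounding an empty 1-gon; it is positive or negative according to the sign of its crossing. Put $$\mu=\frac{a-a^{-1}}{A-B}+1,\quad \mathcal{O}=\frac{Aa^{-1}-Ba}{A-B}-(A+B),\quad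 \gamma=\frac{B^2a-A^2a^{-1}}{A-B}+AB,\quad \xi=\frac{B^3a-A^3a^{-1}}{A-B}.$$ The graphical calculus consists of the following four identities. In each, the diagrams are identical outside a closed disc in the plane and differ inside the disc as described. (G1) If inside the disc one diagram is an arc together with a disjoint circle bounding an empty disc, and the other is the arc alone, then $[\text{arc}\sqcup\text{circle}]=\mu\,[\text{arc}]$. (G2) If inside the disc one diagram consists of one vertex, two of whose cyclically adjacent half-edges are joined to each other by an edge bounding an empty 1-gon, the other two half-edges running to the two boundary points of the disc, and the other diagram is a plain arc joining these two boundary points, then $[\text{vertex with loop}]=\mathcal{O}\,[\text{arc}]$. (G3) Let the disc have four boundary points $NW, NE, SE, SW$ (in cyclic order). Let $P$ consist of two vertices $p,q$ joined by two edges bounding an empty bigon, with the other two half-edges of $p$ running to $NW,SW$ and the other two half-edges of $q$ running to $NE,SE$. Let $H$ consist of two disjoint arcs joining $NW$ to $NE$ and $SW$ to $SE$; let $K$ consist of two disjoint arcs joining $NW$ to $SW$ and $NE$ to $SE$; let $X$ be a single vertex joined to the four boundary points. Then $$[P]=(1-AB)[H]+\gamma[K]-(A+B)[X].$$ (G4) Let the disc have six boundary points $1,\dots,6$ in cyclic order. Let $T$ consist of three vertices $p_{12},p_{34},p_{56}$, pairwise joined by single edges bounding an empty triangle, where the remaining two half-edges of $p_{ij}$ run to the boundary points $i$ and $j$; let $T'$ be defined in the same way with three vertices $p_{23},p_{45},p_{61}$. (Thus $T$ and $T'$ are the two generic positions of three chords $1$–$4$, $2$–$5$, $3$–$6$.)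 For cyclically adjacent $i,j$ let $V_{ij}$ consist of an arc joining $i$ to $j$ and, disjoint from it, one vertex joined to the four other boundary points. Let $R$ consist of three disjoint arcs joining $1$–$2$, $3$–$4$, $5$–$6$, and $R'$ of three disjoint arcs joining $2$–$3$, $4$–$5$, $6$–$1$. Then $$[T]-[T']=AB\big([V_{12}]+[V_{34}]+[V_{56}]-[V_{23}]-[V_{45}]-[V_{61}]\big)+\xi\big([R']-[R]\big).$$ *)

(* Defs.v *)
From HB Require Import structures.
From mathcomp Require Import all_boot all_order all_algebra.
From mathcomp Require Import fraction.
From mathcomp Require Import zify.
From mathcomp Require Import mpoly.
From Stdlib Require Import Relation_Operators.

Set Implicit Arguments.
Unset Strict Implicit.
Unset Printing Implicit Defensive.

(** * Diagrams

  Plane diagrams are encoded by the usual Morse (sliced) presentation.  After a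
  small planar isotopy the height function is generic on the diagram, which is
  then swept from bottom to top by finitely many horizontal slices.  Each slice
  consists of vertical strands and of one elementary piece: a local minimum
  [Cup], a local maximum [Cap], or a node with two half-edges going down and two
  going up.  Strands are numbered from left to right, starting with 0.

  [Crossing over] has its strand from bottom left to top right as the over
  strand iff [over = true].  The edges carry no orientation. *)

Inductive node := Crossing of bool | Vertex.

Inductive elementary := Cup | Cap | Node of node.

Definition inputs (e : elementary) : nat := if e is Cup then 0 else 2.
Definition outputs (e : elementary) : nat := if e is Cap then 0 else 2.

(** The slice [(i, e)] has [i] vertical strands to the left of [e]; the number
  of strands to its right is determined by the width at that level. *)
Definition slice : Type := (nat * elementary)%type.

Definition cup (i : nat) : slice := (i, Cup).
Definition cap (i : nat) : slice := (i, Cap).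
Definition nd (x : node) (i : nat) : slice := (i, Node x).
Definition vtx (i : nat) : slice := nd Vertex i.

Definition step (n : nat) (s : slice) : option nat :=
  if s.1 + inputs s.2 <= n then Some (n - inputs s.2 + outputs s.2) else None.

(** The width at the top of a word which has width [n] at its bottom, or [None]
  if some slice does not fit. *)
Fixpoint run (n : nat) (w : seq slice) : option nat :=
  if w is s :: w' then obind (run^~ w') (step n s) else Some n.

(** A picture in a closed disc, drawn as a rectangle, with [m] boundary points
  on the bottom side and [n] on the top side. *)
Definition tangle (m n : nat) : Type := {w : seq slice | run m w == Some n}.

(** A nonempty closed diagram in the plane. *)
Definition diagram : Type :=
  {w : seq slice | (run 0 w == Some 0) && (0 < size w)}.

Definition shift (k : nat) (w : seq slice) : seq slice :=
  [seq (k + s.1, s.2) | s <- w].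

(** The outside of a closed disc (a rectangle) meeting a diagram in [m] points
  on its bottom side and [n] on its top side: what lies below the disc, the
  numbers of strands passing to the left and to the right of it, and what lies
  above it.  A disc in any other position is brought to this form by a planar
  isotopy, which also allows boundary points to be moved from one side of the
  rectangle to the other. *)
Record outside (m n : nat) : Type := Outside {
  below : seq slice;
  left : nat;
  right : nat;
  above : seq slice;
  belowP : run 0 below == Some (left + m + right);
  aboveP : run (left + n + right) above == Some 0;
  boundary_gt0 : 0 < m + n
}.

Lemma run_cat n v w : run n (v ++ w) = obind (run^~ w) (run n v).
Proof. by elim: v n => //= s v IHv n; case: (step n s). Qed.

Lemma run_shift k r w m n :
  run m w = Some n -> run (k + m + r) (shift k w) = Some (k + n + r).
Proof.
elim: w m => [|[i e] w IHw] m /=; first by case=> ->.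
rewrite /step /=; case: leqP => //= le_m /IHw <-.
have le_e : inputs e <= m by apply: leq_trans le_m; rewrite leq_addl.
rewrite -!addnA leq_add2l (leq_trans le_m) ?leq_addr //=; congr run.
rewrite -addnBA ?(leq_trans le_e) ?leq_addr // -addnBAC //.
by rewrite -!addnA; congr (_ + (_ + _)); rewrite addnC.
Qed.

Section Plug.

Variables (m n : nat) (d : outside m n) (t : tangle m n).

Definition plug_word : seq slice := below d ++ shift (left d) (sval t) ++ above d.

Lemma plug_wordP : (run 0 plug_word == Some 0) && (0 < size plug_word).
Proof.
rewrite /plug_word !run_cat (eqP (belowP d)) /= run_cat.
rewrite (run_shift (left d) (right d) (eqP (svalP t))) /= aboveP /= !size_cat.
have := belowP d; have := aboveP d; have := boundary_gt0 d.
case: (below d) => //=; case: (above d) => /= [|? ?]; last by rewrite addnS addnS.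
move=> mn_gt0 /eqP[/eqP]; rewrite !addn_eq0 => /andP[/andP[_ n0] _].
move=> /eqP[/esym/eqP]; rewrite !addn_eq0 => /andP[/andP[_ m0] _].
by rewrite (eqP m0) (eqP n0) in mn_gt0.
Qed.

(** The diagram which looks like [t] inside the disc and like [d] outside. *)
Definition plug : diagram := exist _ plug_word plug_wordP.

End Plug.

(** * Planar isotopy *)

Definition strand : tangle 1 1 := exist _ [::] isT.
Definition vertical_arcs : tangle 2 2 := exist _ [::] isT.
Definition horizontal_arcs : tangle 2 2 := exist _ [:: cap 0; cup 0] isT.
Definition one_node (x : node) : tangle 2 2 := exist _ [:: nd x 0] isT.

Lemma exchange_lowP g e e' :
  run (inputs e + g + inputs e') [:: (0, e); (outputs e + g, e')]
  == Some (outputs e + g + outputs e').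
Proof.
rewrite /= /step /= ifT /=; last by lia.
by rewrite ifT /=; last lia; apply/eqP; congr Some; lia.
Qed.

Lemma exchange_highP g e e' :
  run (inputs e + g + inputs e') [:: (inputs e + g, e'); (0, e)]
  == Some (outputs e + g + outputs e').
Proof.
rewrite /= /step /= ifT /=; last by lia.
by rewrite ifT /=; last lia; apply/eqP; congr Some; lia.
Qed.

(** Two elementary pieces separated horizontally by [g] strands, the left one
  being lower, resp. higher, than the right one. *)
Definition exchange_low (g : nat) (e e' : elementary) :
    tangle (inputs e + g + inputs e') (outputs e + g + outputs e') :=
  exist _ [:: (0, e); (outputs e + g, e')] (exchange_lowP g e e').
Definition exchange_high (g : nat) (e e' : elementary) :
    tangle (inputs e + g + inputs e') (outputs e + g + outputs e') :=
  exist _ [:: (inputs e + g, e'); (0, e)] (exchange_highP g e e').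

Definition zigzag (s : bool) : tangle 1 1 :=
  if s then exist _ [:: cup 1; cap 0] isT else exist _ [:: cup 0; cap 1] isT.

(** The node [x] with its half-edges bent so that bottom left, top left, top
  right, bottom right leave at top left, top right, bottom right, bottom left
  respectively: a clockwise quarter turn of [x]. *)
Definition bent_node (x : node) : tangle 2 2 :=
  exist _ [:: cup 0; nd x 1; cap 2] isT.
Definition quarter_turn (x : node) : node :=
  if x is Crossing over then Crossing (~~ over) else Vertex.

(** Planar isotopies are generated by exchanges of heights, cancellations of a
  maximum with an adjacent minimum, and rotations of nodes (together with the
  isotopies that keep the height function generic, which do not change the
  word). *)
Inductive planar_step : diagram -> diagram -> Prop :=
| PlanarExchange g e e'
    (d : outside (inputs e + g + inputs e') (outputs e + g + outputs e')) :
    planar_step (plug d (exchange_low g e e')) (plug d (exchange_high g e e'))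
| PlanarZigzag s (d : outside 1 1) :
    planar_step (plug d (zigzag s)) (plug d strand)
| PlanarRotate x (d : outside 2 2) :
    planar_step (plug d (bent_node x)) (plug d (one_node (quarter_turn x))).

Definition planar_isotopy : diagram -> diagram -> Prop :=
  clos_refl_sym_trans diagram planar_step.

(** * Regular isotopy *)

Definition crossing (over : bool) : tangle 2 2 := one_node (Crossing over).
Definition vertex : tangle 2 2 := one_node Vertex.

Definition move2 (over : bool) : tangle 2 2 :=
  exist _ [:: nd (Crossing over) 0; nd (Crossing (~~ over)) 0] isT.

(** Three strands starting at the bottom at 0, 1, 2 and ending in reverse order:
  [c01], [c02], [c12] say whether 0 is over 1, 0 over 2 and 1 over 2.  In
  [move3_left] strands 0 and 1 cross first, in [move3_right] strands 1 and 2. *)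
Definition move3_left (c01 c02 c12 : bool) : tangle 3 3 :=
  exist _ [:: nd (Crossing c01) 0; nd (Crossing c02) 1; nd (Crossing c12) 0] isT.
Definition move3_right (c01 c02 c12 : bool) : tangle 3 3 :=
  exist _ [:: nd (Crossing c12) 1; nd (Crossing c02) 0; nd (Crossing c01) 1] isT.

(** The strands can be ordered by height: this excludes 0 > 1 > 2 > 0 and
  0 < 1 < 2 < 0. *)
Definition layered (c01 c02 c12 : bool) : bool := (c01 == c02) || (c02 == c12).

(** A strand going from bottom left to top right, over (if [over]) or under the
  two upper, resp. lower, half-edges of a vertex.  The other positions of the
  strand are obtained by rotating the disc. *)
Definition move4_above (over : bool) : tangle 3 3 :=
  exist _ [:: vtx 1; nd (Crossing over) 0; nd (Crossing over) 1] isT.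
Definition move4_below (over : bool) : tangle 3 3 :=
  exist _ [:: nd (Crossing over) 0; nd (Crossing over) 1; vtx 0] isT.

Definition move5 (over : bool) : tangle 2 2 :=
  exist _ [:: nd (Crossing over) 0; vtx 0; nd (Crossing (~~ over)) 0] isT.

Inductive regular_step : diagram -> diagram -> Prop :=
| RegularPlanar D D' : planar_step D D' -> regular_step D D'
| Regular2 over (d : outside 2 2) :
    regular_step (plug d (move2 over)) (plug d vertical_arcs)
| Regular3 c01 c02 c12 (d : outside 3 3) : layered c01 c02 c12 ->
    regular_step (plug d (move3_left c01 c02 c12))
                 (plug d (move3_right c01 c02 c12))
| Regular4 over (d : outside 3 3) :
    regular_step (plug d (move4_above over)) (plug d (move4_below over))
| Regular5 over (d : outside 2 2) :
    regular_step (plug d (move5 over)) (plug d vertex).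

Definition regular_isotopy : diagram -> diagram -> Prop :=
  clos_refl_sym_trans diagram regular_step.

(** * Signs, smoothings, curls *)

(** The sign of a crossing whose bottom-left-to-top-right strand is directed
  upwards iff [o1] and whose bottom-right-to-top-left strand is directed upwards
  iff [o2]. *)
Definition positive (over o1 o2 : bool) : bool := over == (o1 == o2).

(** The smoothing compatible with the directions [o1], [o2]. *)
Definition oriented_smoothing (o1 o2 : bool) : tangle 2 2 :=
  if o1 == o2 then vertical_arcs else horizontal_arcs.

Definition A_smoothing (over : bool) : tangle 2 2 := oriented_smoothing true over.
Definition B_smoothing (over : bool) : tangle 2 2 :=
  oriented_smoothing true (~~ over).

Lemma A_smoothingP over o1 o2 :
  positive over o1 o2 -> A_smoothing over = oriented_smoothing o1 o2.
Proof. by case: over o1 o2 => [] [] []. Qed.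

Lemma B_smoothingP over o1 o2 :
  ~~ positive over o1 o2 -> B_smoothing over = oriented_smoothing o1 o2.
Proof. by case: over o1 o2 => [] [] []. Qed.

(** A node with two adjacent half-edges joined by an edge bounding an empty
  1-gon, to the right or to the left of the node.  For a crossing, the strand
  directed from bottom to top passes upwards both times, so that the sign of the
  curl is [positive over true true], that is [over]. *)
Definition looped (x : node) (on_right : bool) : tangle 1 1 :=
  if on_right then exist _ [:: cup 1; nd x 0; cap 1] isT
  else exist _ [:: cup 0; nd x 1; cap 0] isT.

Definition positive_curl : bool -> tangle 1 1 := looped (Crossing true).
Definition negative_curl : bool -> tangle 1 1 := looped (Crossing false).

(** * The graphical calculus *)

Local Open Scope ring_scope.
Import GRing.Theory.

(** The field Q(A, B, a). *)
Definition K : fieldType := {fraction {mpoly rat[3]}}.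

Definition vA : K := FracField.tofrac ('X_(0 : 'I_3) : {mpoly rat[3]}).
Definition vB : K := FracField.tofrac ('X_(1 : 'I_3) : {mpoly rat[3]}).
Definition va : K := FracField.tofrac ('X_(2 : 'I_3) : {mpoly rat[3]}).

Definition c_mu : K := (va - va^-1) / (vA - vB) + 1.
Definition c_O : K := (vA * va^-1 - vB * va) / (vA - vB) - (vA + vB).
Definition c_gamma : K :=
  (vB ^+ 2 * va - vA ^+ 2 * va^-1) / (vA - vB) + vA * vB.
Definition c_xi : K := (vB ^+ 3 * va - vA ^+ 3 * va^-1) / (vA - vB).

(** Boundary points on the bottom (top) side of a rectangle are SW, SE (NW, NE)
  for four points, and 1, 2, 3 (6, 5, 4) from left to right for six points. *)

Definition arc_circle (on_right : bool) : tangle 1 1 :=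
  if on_right then exist _ [:: cup 1; cap 1] isT
  else exist _ [:: cup 0; cap 0] isT.

Definition bigon : tangle 2 2 :=
  exist _ [:: cup 1; vtx 0; vtx 2; cap 1] isT.

Definition triangle : tangle 3 3 := exist _ [:: vtx 0; vtx 1; vtx 0] isT.
Definition triangle' : tangle 3 3 := exist _ [:: vtx 1; vtx 0; vtx 1] isT.
Definition V12 : tangle 3 3 := exist _ [:: cap 0; cup 0; vtx 1] isT.
Definition V34 : tangle 3 3 := exist _ [:: vtx 0] isT.
Definition V56 : tangle 3 3 := exist _ [:: vtx 1; cap 0; cup 0] isT.
Definition V23 : tangle 3 3 := exist _ [:: cap 1; cup 1; vtx 0] isT.
Definition V45 : tangle 3 3 := exist _ [:: vtx 0; cap 1; cup 1] isT.
Definition V61 : tangle 3 3 := exist _ [:: vtx 1] isT.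
Definition arcs12_34_56 : tangle 3 3 := exist _ [:: cap 0; cup 0] isT.
Definition arcs23_45_61 : tangle 3 3 := exist _ [:: cap 1; cup 1] isT.

Section Calculus.

Variable br : diagram -> K.

Definition identity_G1 : Prop := forall (d : outside 1 1) (on_right : bool),
  br (plug d (arc_circle on_right)) = c_mu * br (plug d strand).

Definition identity_G2 : Prop := forall (d : outside 1 1) (on_right : bool),
  br (plug d (looped Vertex on_right)) = c_O * br (plug d strand).

Definition identity_G3 : Prop := forall d : outside 2 2,
  br (plug d bigon) =
    (1 - vA * vB) * br (plug d horizontal_arcs)
    + c_gamma * br (plug d vertical_arcs) - (vA + vB) * br (plug d vertex).

Definition identity_G4 : Prop := forall d : outside 3 3,
  br (plug d triangle) - br (plug d triangle') =
    vA * vB * (br (plug d V12) + br (plug d V34) + br (plug d V56)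
               - br (plug d V23) - br (plug d V45) - br (plug d V61))
    + c_xi * (br (plug d arcs23_45_61) - br (plug d arcs12_34_56)).

Definition graphical_calculus : Prop :=
  [/\ identity_G1, identity_G2, identity_G3 & identity_G4].

Definition skein_relation : Prop := forall (d : outside 2 2) (over : bool),
  br (plug d (crossing over)) =
    vA * br (plug d (A_smoothing over)) + vB * br (plug d (B_smoothing over))
    + br (plug d vertex).

End Calculus.

(* Main.v *)
Require Import Defs.
From mathcomp Require Import all_boot all_order all_algebra.
From mathcomp Require Import fraction mpoly ring.
From Stdlib Require Import Relation_Operators.

Set Implicit Arguments.
Unset Strict Implicit.
Unset Printing Implicit Defensive.

Import GRing.Theory.

(** For a fixed outside, the bracket of the words drawn inside the disc behaves
  like a linear form on the algebra generated by [e = cap; cup] and [x = vertex], and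
  a crossing is [p + q e + x] with [{p, q} = {A, B}].  Planar isotopy gives
  [e e = mu e], [e x = x e = O e] and, after a quarter turn of (G3), an
  expression of [x x].
  - (II) and the curls follow by expansion and comparison of coefficients.
  - (IV) for one position of the strand follows by expanding both crossings:
    the difference of the two sides is the difference of the two sides of (G4),
    because [p] and [q] are the roots of [X^2 - (A + B) X + A B].  Multiplying
    by inverse crossings (II) gives the position where the strand runs the
    other way.
  - (III): a strand lies over, or under, the crossing of the two others; expand
    that crossing and use (IV) for the vertex and (II) for the smoothings.
  - (V): [e x = x e] implies that crossings commute with [x], then use (II). *)

Lemma shift_cat k v w : shift k (v ++ w) = shift k v ++ shift k w.
Proof. exact: map_cat. Qed.

Lemma shiftD k l w : shift k (shift l w) = shift (k + l) w.
Proof. by rewrite /shift -map_comp; apply: eq_map => s /=; rewrite addnA. Qed.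

(** * Identities between the coefficients *)

Section Coefficients.

Local Open Scope ring_scope.

Lemma vA_sub_vB_neq0 : vA - vB != 0.
Proof.
rewrite subr_eq0 tofrac_eq; apply/eqP => /(congr1 (mcoeff U_(0))).
by rewrite !mcoeffXU /= => /eqP; rewrite oner_eq0.
Qed.

Lemma va_neq0 : va != 0.
Proof.
rewrite tofrac_eq0; apply/eqP => /(congr1 (mcoeff U_(2))).
by rewrite mcoeffXU mcoeff0 eqxx => /eqP; rewrite oner_eq0.
Qed.

(* [field] is run over an abstract field: it does not terminate in
   reasonable time on the concrete field of fractions. *)
Local Ltac coef_field :=
  rewrite /c_mu /c_O /c_gamma /c_xi;
  move: va vA vB va_neq0 vA_sub_vB_neq0;
  move: K => F a A B a_neq0 AB_neq0; field; do ?[apply/andP; split]; assumption.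

(** Says that e has coefficient 0 in the expansion of (p + q e + x)(q + p e + x), as needed for
    (II). *)
Lemma c_gammaE : c_gamma = - (vA ^+ 2 + vB ^+ 2 + vA * vB * c_mu + (vA + vB) * c_O).
Proof. by coef_field. Qed.

(** In (IV) the right-hand side is the coefficient of e on strands 1, 2 in one expansion and of e on
    strands 0, 1 in the other; it has to match (G4). *)
Lemma c_xiE : c_xi = vA * vB * c_O + (vA + vB) * c_gamma.
Proof. by coef_field. Qed.

(** [Crossing true] is positive with both strands directed upwards, so its A-smoothing is vertical;
    that of [Crossing false] is horizontal. *)
Definition coef_vert (over : bool) : K := if over then vA else vB.
Definition coef_horiz (over : bool) : K := if over then vB else vA.

(** Closing p + q e + x on one side gives p times a strand with a circle, q times a strand, and a
    looped vertex. *)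
Lemma positive_curl_factor : coef_vert true * c_mu + coef_horiz true + c_O = va.
Proof. by rewrite /coef_vert /coef_horiz; coef_field. Qed.

Lemma negative_curl_factor :
  coef_vert false * c_mu + coef_horiz false + c_O = va^-1.
Proof. by rewrite /coef_vert /coef_horiz; coef_field. Qed.

End Coefficients.

(** * Discs inside a disc *)

Section SubDisc.

Variables (m n M N : nat) (d : outside M N).
Variables (a b : seq slice) (l r : nat).
Hypotheses (aP : run M a = Some (l + m + r)).
Hypotheses (bP : run (l + n + r) b = Some N) (mn_gt0 : 0 < m + n).

Fact sub_belowP :
  run 0 (below d ++ shift (left d) a) == Some (left d + l + m + (r + right d)).
Proof.
rewrite run_cat (eqP (belowP d)) /= (run_shift _ _ aP).
by rewrite !addnA.
Qed.

Fact sub_aboveP :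
  run (left d + l + n + (r + right d)) (shift (left d) b ++ above d) == Some 0.
Proof.
have := run_shift (left d) (right d) bP; rewrite !addnA run_cat => -> /=.
exact: aboveP.
Qed.

(** Inside the larger disc, the smaller one has [a] below it, [b] above it, and [l] and [r] strands
    to its left and right. *)
Definition sub_disc : outside m n := Outside sub_belowP sub_aboveP mn_gt0.

End SubDisc.

Lemma quarter_turnK : involutive quarter_turn.
Proof. by case=> // over; rewrite /= negbK. Qed.

(** * Words in a disc, up to equality of brackets *)

Section Bracket.

Variable br : diagram -> K.

(* Indexing by all words, with junk value 0 on those which do not close up to a
   diagram, avoids transporting validity proofs along isotopies. *)
Definition value m n (d : outside m n) (w : seq slice) : K :=
  oapp br 0%R (insub (below d ++ shift (left d) w ++ above d)).

Lemma value_plug m n (d : outside m n) (t : tangle m n) :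
  value d (sval t) = br (plug d t).
Proof. by rewrite /value -[_ ++ _]/(\val (plug d t)) valK. Qed.

Lemma value_sub m n M N (d : outside M N) a b l r
    (aP : run M a = Some (l + m + r)) (bP : run (l + n + r) b = Some N)
    (mn_gt0 : 0 < m + n) w :
  value (sub_disc d aP bP mn_gt0) w = value d (a ++ shift l w ++ b).
Proof. by rewrite /value /= !shift_cat shiftD !catA. Qed.

Definition teq m n (w w' : seq slice) : Prop :=
  forall d : outside m n, value d w = value d w'.

Lemma teq_trans m n v w w' : teq m n w v -> teq m n v w' -> teq m n w w'.
Proof. by move=> e e' d; rewrite e. Qed.

Lemma teq_sym m n w w' : teq m n w w' -> teq m n w' w.
Proof. by move=> e d. Qed.

(** What surrounds the smaller disc is again an outside, so [teq] is a congruence. *)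
Lemma teq_in M N a l r b m n w w' :
    teq m n w w' -> 0 < m + n ->
    run M a = Some (l + m + r) -> run (l + n + r) b = Some N ->
  teq M N (a ++ shift l w ++ b) (a ++ shift l w' ++ b).
Proof.
by move=> e mn_gt0 aP bP d; rewrite -!(value_sub d aP bP mn_gt0) e.
Qed.

(** * Consequences of planar isotopy *)

Hypothesis br_planar : forall D D' : diagram, planar_isotopy D D' -> br D = br D'.

Lemma teq_planar m n (t t' : tangle m n) :
  (forall d : outside m n, planar_step (plug d t) (plug d t')) ->
  teq m n (sval t) (sval t').
Proof.
by move=> tt' d; rewrite !value_plug; apply/br_planar/rst_step/tt'.
Qed.

Lemma teq_exchange g e e' :
  teq (inputs e + g + inputs e') (outputs e + g + outputs e')
    [:: (0, e); (outputs e + g, e')] [:: (inputs e + g, e'); (0, e)].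
Proof.
by apply: (@teq_planar _ _ (exchange_low g e e') (exchange_high g e e')) => d;
  constructor.
Qed.

Lemma teq_zigzag_right : teq 1 1 [:: cup 1; cap 0] [::].
Proof. by apply: (@teq_planar _ _ (zigzag true) strand) => d; constructor. Qed.

Lemma teq_zigzag_left : teq 1 1 [:: cup 0; cap 1] [::].
Proof. by apply: (@teq_planar _ _ (zigzag false) strand) => d; constructor. Qed.

Lemma teq_bent x : teq 2 2 [:: cup 0; nd x 1; cap 2] [:: nd (quarter_turn x) 0].
Proof.
by apply: (@teq_planar _ _ (bent_node x) (one_node (quarter_turn x))) => d;
  constructor.
Qed.

(* [via v by e at a l r b] replaces the left-hand side [a; w; b] by [v], where
   [e] rewrites [w] and [l], [r] are the numbers of strands on its two sides. *)
Local Tactic Notation "via" constr(v) "by" uconstr(e) "at" uconstr(a)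
    uconstr(l) uconstr(r) uconstr(b) :=
  apply: (@teq_trans _ _ v);
  first by refine (@teq_in _ _ a l r b _ _ _ _ e _ _ _).

(** Bending the turned node adds a minimum and a maximum; after exchanges of heights the new maximum
    cancels the original minimum. *)
Lemma teq_cup_slide x : teq 1 3 [:: cup 1; nd (quarter_turn x) 0] [:: cup 0; nd x 1].
Proof.
via [:: cup 1; cup 0; nd x 1; cap 2] by (teq_sym (teq_bent x))
  at [:: cup 1] 0 1 [::].
via [:: cup 0; cup 3; nd x 1; cap 2] by (teq_sym (@teq_exchange 1 Cup Cup))
  at [::] 0 0 [:: nd x 1; cap 2].
via [:: cup 0; nd x 1; cup 3; cap 2] by (teq_sym (@teq_exchange 0 (Node x) Cup))
  at [:: cup 0] 1 0 [:: cap 2].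
by via [:: cup 0; nd x 1] by teq_zigzag_right at [:: cup 0; nd x 1] 2 0 [::].
Qed.

Lemma teq_cap_slide x : teq 3 1 [:: nd x 0; cap 1] [:: nd (quarter_turn x) 1; cap 0].
Proof.
apply: teq_sym.
via [:: cup 1; nd x 2; cap 3; cap 0] by (teq_sym (teq_bent x)) at [::] 1 0 [:: cap 0].
via [:: cup 1; nd x 2; cap 0; cap 1] by (teq_sym (@teq_exchange 1 Cap Cap))
  at [:: cup 1; nd x 2] 0 0 [::].
via [:: cup 1; cap 0; nd x 0; cap 1] by (teq_sym (@teq_exchange 0 Cap (Node x)))
  at [:: cup 1] 0 1 [:: cap 1].
by via [:: nd x 0; cap 1] by teq_zigzag_right at [::] 0 2 [:: nd x 0; cap 1].
Qed.

(** The left-hand side shows the vertex with its loop on the left, the form to which (G2)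
    applies. *)
Lemma teq_vtx_cap : teq 2 0 [:: cup 0; vtx 1; cap 0; cap 0] [:: vtx 0; cap 0].
Proof.
via [:: cup 1; vtx 0; cap 0; cap 0] by (teq_sym (teq_cup_slide Vertex))
  at [::] 0 1 [:: cap 0; cap 0].
via [:: cup 1; vtx 0; cap 2; cap 0] by (@teq_exchange 0 Cap Cap)
  at [:: cup 1; vtx 0] 0 0 [::].
via [:: cup 1; cap 2; vtx 0; cap 0] by (@teq_exchange 0 (Node Vertex) Cap)
  at [:: cup 1] 0 0 [:: cap 0].
by via [:: vtx 0; cap 0] by teq_zigzag_left at [::] 1 0 [:: vtx 0; cap 0].
Qed.

Lemma teq_vtx_cup : teq 0 2 [:: cup 0; cup 0; vtx 1; cap 0] [:: cup 0; vtx 0].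
Proof.
via [:: cup 0; cup 0; vtx 0; cap 1] by (teq_sym (teq_cap_slide Vertex))
  at [:: cup 0; cup 0] 0 1 [::].
via [:: cup 0; cup 2; vtx 0; cap 1] by (teq_sym (@teq_exchange 0 Cup Cup))
  at [::] 0 0 [:: vtx 0; cap 1].
via [:: cup 0; vtx 0; cup 2; cap 1] by (teq_sym (@teq_exchange 0 (Node Vertex) Cup))
  at [:: cup 0] 0 0 [:: cap 1].
by via [:: cup 0; vtx 0] by teq_zigzag_right at [:: cup 0; vtx 0] 1 0 [::].
Qed.

(** (G1) needs an arc beside the circle: a circle above a maximum is moved next to one of its
    legs. *)
Lemma teq_circle : teq 2 0 [:: cup 0; cap 0; cap 0] [:: cap 0; cup 0; cap 0].
Proof.
via [:: cup 0; cap 2; cap 0] by (@teq_exchange 0 Cap Cap) at [:: cup 0] 0 0 [::].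
by via [:: cap 0; cup 0; cap 0] by (@teq_exchange 0 Cup Cap) at [::] 0 0 [:: cap 0].
Qed.

(* In the next four lemmas [cup 2; w; cap 0], with [w] drawn on strands 1 and 2,
   is a quarter turn of [w]: this transforms (G3) into an expression of
   [vtx 0; vtx 0]. *)
Lemma teq_unbend_bigon :
  teq 2 2 [:: cup 2; cup 2; vtx 1; vtx 3; cap 2; cap 0] [:: vtx 0; vtx 0].
Proof.
via [:: cup 2; cup 1; vtx 2; vtx 3; cap 2; cap 0] by (teq_cup_slide Vertex)
  at [:: cup 2] 1 2 [:: vtx 3; cap 2; cap 0].
via [:: cup 2; cup 1; vtx 2; vtx 2; cap 3; cap 0] by (teq_sym (teq_cap_slide Vertex))
  at [:: cup 2; cup 1; vtx 2] 2 1 [:: cap 0].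
via [:: cup 2; cup 1; vtx 2; vtx 2; cap 0; cap 1] by (teq_sym (@teq_exchange 1 Cap Cap))
  at [:: cup 2; cup 1; vtx 2; vtx 2] 0 1 [::].
via [:: cup 2; cup 1; vtx 2; cap 0; vtx 0; cap 1]
  by (teq_sym (@teq_exchange 0 Cap (Node Vertex)))
  at [:: cup 2; cup 1; vtx 2] 0 2 [:: cap 1].
via [:: cup 2; cup 1; cap 0; vtx 0; vtx 0; cap 1]
  by (teq_sym (@teq_exchange 0 Cap (Node Vertex)))
  at [:: cup 2; cup 1] 0 2 [:: vtx 0; cap 1].
via [:: cup 2; vtx 0; vtx 0; cap 1] by teq_zigzag_right
  at [:: cup 2] 0 3 [:: vtx 0; vtx 0; cap 1].
via [:: vtx 0; cup 2; vtx 0; cap 1] by (teq_sym (@teq_exchange 0 (Node Vertex) Cup))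
  at [::] 0 0 [:: vtx 0; cap 1].
via [:: vtx 0; vtx 0; cup 2; cap 1] by (teq_sym (@teq_exchange 0 (Node Vertex) Cup))
  at [:: vtx 0] 0 0 [:: cap 1].
by via [:: vtx 0; vtx 0] by teq_zigzag_right at [:: vtx 0; vtx 0] 1 0 [::].
Qed.

Lemma teq_unbend_horizontal : teq 2 2 [:: cup 2; cap 1; cup 1; cap 0] [::].
Proof.
via [:: cup 1; cap 0] by teq_zigzag_right at [::] 1 0 [:: cup 1; cap 0].
by via (Nil slice) by teq_zigzag_right at [::] 0 1 [::].
Qed.

Lemma teq_unbend_vertical : teq 2 2 [:: cup 2; cap 0] [:: cap 0; cup 0].
Proof. exact: teq_sym (@teq_exchange 0 Cap Cup). Qed.

Lemma teq_unbend_vtx : teq 2 2 [:: cup 2; vtx 1; cap 0] [:: vtx 0].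
Proof.
via [:: cup 1; vtx 2; cap 0] by (teq_cup_slide Vertex) at [::] 1 0 [:: cap 0].
via [:: cup 1; cap 0; vtx 0] by (teq_sym (@teq_exchange 0 Cap (Node Vertex)))
  at [:: cup 1] 0 0 [::].
by via [:: vtx 0] by teq_zigzag_right at [::] 0 1 [:: vtx 0].
Qed.

(* In names, [e1], [e2], [x1], [x2] denote [cap; cup] and the vertex on strands
   0, 1 and on strands 1, 2. *)
Lemma teq_x2e1e2 :
  teq 3 3 [:: vtx 1; cap 0; cup 0; cap 1; cup 1] [:: vtx 0; cap 1; cup 1].
Proof.
via [:: vtx 1; cap 0; cup 1] by teq_zigzag_left at [:: vtx 1; cap 0] 0 0 [:: cup 1].
by via [:: vtx 0; cap 1; cup 1] by (teq_sym (teq_cap_slide Vertex))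
  at [::] 0 0 [:: cup 1].
Qed.

Lemma teq_e1e2x1 :
  teq 3 3 [:: cap 0; cup 0; cap 1; cup 1; vtx 0] [:: cap 0; cup 0; vtx 1].
Proof.
via [:: cap 0; cup 1; vtx 0] by teq_zigzag_left at [:: cap 0] 0 0 [:: cup 1; vtx 0].
by via [:: cap 0; cup 0; vtx 1] by (teq_cup_slide Vertex) at [:: cap 0] 0 0 [::].
Qed.

Lemma teq_x2e1x2 :
  teq 3 3 [:: vtx 1; cap 0; cup 0; vtx 1] [:: vtx 0; cap 1; cup 1; vtx 0].
Proof.
via [:: vtx 0; cap 1; cup 0; vtx 1] by (teq_sym (teq_cap_slide Vertex))
  at [::] 0 0 [:: cup 0; vtx 1].
by via [:: vtx 0; cap 1; cup 1; vtx 0] by (teq_sym (teq_cup_slide Vertex))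
  at [:: vtx 0; cap 1] 0 0 [::].
Qed.

(** * Linear combinations of words *)

Definition comb m n (d : outside m n) (c : seq (K * seq slice)) : K :=
  foldr (fun p s => (p.1 * value d p.2 + s)%R) 0%R c.

Definition lin m n (w : seq slice) (c : seq (K * seq slice)) : Prop :=
  forall d : outside m n, value d w = comb d c.

Lemma lin_in M N (d : outside M N) a l r b m n w c :
    lin m n w c -> 0 < m + n ->
    run M a = Some (l + m + r) -> run (l + n + r) b = Some N ->
  value d (a ++ shift l w ++ b) = comb d [seq (p.1, a ++ shift l p.2 ++ b) | p <- c].
Proof.
move=> wc mn_gt0 aP bP; rewrite -(value_sub d aP bP mn_gt0) wc.
elim: c {wc} => //= p c IHc.
by rewrite (value_sub d aP bP mn_gt0) IHc.
Qed.

(* Applies [lin_in], with positions given as in [via], and computes the resulting words while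
   leaving the coefficients folded. *)
Local Tactic Notation "expand" uconstr(e) "at" constr(d) uconstr(a)
    uconstr(l) uconstr(r) uconstr(b) :=
  let E := fresh in
  pose proof (@lin_in _ _ d a l r b _ _ _ _ e erefl erefl erefl) as E;
  cbv [comb foldr map cat shift fst snd addn Nat.add cup cap vtx nd] in E;
  rewrite {}E.

(** * The calculus and the skein relation as linear relations *)

Hypothesis br_calculus : graphical_calculus br.
Hypothesis br_skein : skein_relation br.

Lemma lin_circle s :
  lin 1 1 (if s then [:: cup 1; cap 1] else [:: cup 0; cap 0]) [:: (c_mu, [::])].
Proof.
move=> d; have [G1 _ _ _] := br_calculus.
by have := G1 d s; rewrite -!value_plug /comb /= addr0; case: s.
Qed.

Lemma lin_loop s :
  lin 1 1 (if s then [:: cup 1; vtx 0; cap 1] else [:: cup 0; vtx 1; cap 0])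
    [:: (c_O, [::])].
Proof.
move=> d; have [_ G2 _ _] := br_calculus.
by have := G2 d s; rewrite -!value_plug /comb /= addr0; case: s.
Qed.

Lemma lin_skein o : lin 2 2 [:: nd (Crossing o) 0]
  [:: (coef_vert o, [::]); (coef_horiz o, [:: cap 0; cup 0]); (1%R, [:: vtx 0])].
Proof.
move=> d; have := br_skein d o; rewrite -!value_plug /comb /= addr0 mul1r.
by case: o => -> /=; rewrite addrA // [(vA * _ + _)%R]addrC.
Qed.

Lemma lin_cap_circle : lin 2 0 [:: cap 0; cup 0; cap 0] [:: (c_mu, [:: cap 0])].
Proof.
by move=> d; rewrite -teq_circle; expand (lin_circle false) at d [::] 0 1 [:: cap 0].
Qed.

Lemma lin_vtx_cap : lin 2 0 [:: vtx 0; cap 0] [:: (c_O, [:: cap 0])].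
Proof.
by move=> d; rewrite -teq_vtx_cap; expand (lin_loop false) at d [::] 0 1 [:: cap 0].
Qed.

Lemma lin_vtx_cup : lin 0 2 [:: cup 0; vtx 0] [:: (c_O, [:: cup 0])].
Proof.
by move=> d; rewrite -teq_vtx_cup; expand (lin_loop false) at d [:: cup 0] 0 1 [::].
Qed.

Lemma lin_bigon : lin 2 2 [:: cup 1; vtx 0; vtx 2; cap 1]
  [:: ((1 - vA * vB)%R, [:: cap 0; cup 0]); (c_gamma, [::]);
      ((- (vA + vB))%R, [:: vtx 0])].
Proof.
move=> d; have [_ _ G3 _] := br_calculus.
by have := G3 d; rewrite -!value_plug /comb /= addr0 mulNr addrA.
Qed.

(** The quarter turn exchanges the two pairs of arcs in (G3), so 1 - AB now goes with the vertical
    arcs. *)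
Lemma lin_vtx_vtx : lin 2 2 [:: vtx 0; vtx 0]
  [:: ((1 - vA * vB)%R, [::]); (c_gamma, [:: cap 0; cup 0]);
      ((- (vA + vB))%R, [:: vtx 0])].
Proof.
move=> d; rewrite -teq_unbend_bigon.
expand lin_bigon at d [:: cup 2] 1 1 [:: cap 0].
by rewrite teq_unbend_horizontal teq_unbend_vertical teq_unbend_vtx.
Qed.

(** Sliding the first vertex along the minimum puts it directly below the second one, where
    [lin_vtx_vtx] applies. *)
Lemma lin_e1x2x1 : lin 3 3 [:: cap 0; cup 0; vtx 1; vtx 0]
  [:: ((1 - vA * vB)%R, [:: cap 0; cup 1]); (c_gamma, [:: cap 0; cup 0]);
      ((- (vA + vB))%R, [:: cap 0; cup 0; vtx 1])].
Proof.
have slide w : run 3 w = Some 3 ->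
    teq 3 3 ([:: cap 0; cup 1; vtx 0] ++ w) ([:: cap 0; cup 0; vtx 1] ++ w).
  by move=> wP; via ([:: cap 0; cup 0; vtx 1] ++ w) by (teq_cup_slide Vertex)
    at [:: cap 0] 0 0 w.
have zigzag : teq 3 3 [:: cap 0; cup 1; cap 0; cup 0] [:: cap 0; cup 0].
  by via [:: cap 0; cup 0] by teq_zigzag_right at [:: cap 0] 0 0 [:: cup 0].
move=> d; rewrite -(slide [:: vtx 0] erefl).
expand lin_vtx_vtx at d [:: cap 0; cup 1] 0 1 [::].
by rewrite zigzag (slide [::] erefl).
Qed.

Lemma lin_x2x1e2 : lin 3 3 [:: vtx 1; vtx 0; cap 1; cup 1]
  [:: ((1 - vA * vB)%R, [:: cap 0; cup 1]); (c_gamma, [:: cap 1; cup 1]);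
      ((- (vA + vB))%R, [:: vtx 0; cap 1; cup 1])].
Proof.
have slide w : run 3 w = Some 3 ->
    teq 3 3 (w ++ [:: vtx 1; cap 0; cup 1]) (w ++ [:: vtx 0; cap 1; cup 1]).
  by move=> wP; via (w ++ [:: vtx 0; cap 1; cup 1]) by
    (teq_sym (teq_cap_slide Vertex)) at w 0 0 [:: cup 1].
have zigzag : teq 3 3 [:: cap 1; cup 1; cap 0; cup 1] [:: cap 1; cup 1].
  by via [:: cap 1; cup 1] by teq_zigzag_right at [:: cap 1] 0 0 [:: cup 1].
move=> d; rewrite -(slide [:: vtx 1] erefl).
expand lin_vtx_vtx at d [::] 1 0 [:: cap 0; cup 1].
by rewrite zigzag (slide [::] erefl).
Qed.

Lemma lin_G4 : lin 3 3 [:: vtx 0; vtx 1; vtx 0]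
  [:: (1%R, [:: vtx 1; vtx 0; vtx 1]);
      ((vA * vB)%R, [:: cap 0; cup 0; vtx 1]); ((vA * vB)%R, [:: vtx 0]);
      ((vA * vB)%R, [:: vtx 1; cap 0; cup 0]);
      ((- (vA * vB))%R, [:: cap 1; cup 1; vtx 0]);
      ((- (vA * vB))%R, [:: vtx 0; cap 1; cup 1]); ((- (vA * vB))%R, [:: vtx 1]);
      (c_xi, [:: cap 1; cup 1]); ((- c_xi)%R, [:: cap 0; cup 0])].
Proof.
move=> d; have [_ _ _ G4] := br_calculus.
have := G4 d; rewrite -!value_plug /comb /= => /(canRL (subrK _)) ->; ring.
Qed.

(** * Invariance under the moves *)

Lemma teq_move2 o : teq 2 2 [:: nd (Crossing o) 0; nd (Crossing (~~ o)) 0] [::].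
Proof.
move=> d; expand (lin_skein o) at d [::] 0 0 [:: nd (Crossing (~~ o)) 0].
expand (lin_skein (~~ o)) at d [::] 0 0 [::].
expand (lin_skein (~~ o)) at d [:: cap 0; cup 0] 0 0 [::].
expand (lin_skein (~~ o)) at d [:: vtx 0] 0 0 [::].
expand lin_cap_circle at d [::] 0 0 [:: cup 0].
expand lin_vtx_cup at d [:: cap 0] 0 0 [::].
expand lin_vtx_cap at d [::] 0 0 [:: cup 0].
expand lin_vtx_vtx at d [::] 0 0 [::].
(* The coefficient of the vertical arcs is AB + (1 - AB), that of x is (A + B) - (A + B), and that
   of e vanishes by [c_gammaE]. *)
by rewrite c_gammaE; case: o; rewrite /coef_vert /coef_horiz /=; ring.
Qed.

Lemma teq_move4 o :
  teq 3 3 [:: vtx 1; nd (Crossing o) 0; nd (Crossing o) 1]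
          [:: nd (Crossing o) 0; nd (Crossing o) 1; vtx 0].
Proof.
move=> d; expand (lin_skein o) at d [:: vtx 1] 0 1 [:: nd (Crossing o) 1].
expand (lin_skein o) at d [:: vtx 1] 1 0 [::].
expand (lin_skein o) at d [:: vtx 1; cap 0; cup 0] 1 0 [::].
expand (lin_skein o) at d [:: vtx 1; vtx 0] 1 0 [::].
expand (lin_skein o) at d [::] 0 1 [:: nd (Crossing o) 1; vtx 0].
expand (lin_skein o) at d [::] 1 0 [:: vtx 0].
expand (lin_skein o) at d [:: cap 0; cup 0] 1 0 [:: vtx 0].
expand (lin_skein o) at d [:: vtx 0] 1 0 [:: vtx 0].
(* The terms in x2e1x2 and x1e2x1 now cancel between the two sides; the other two words become x1e2
   and e1x2, which occur in (G4). *)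
rewrite teq_x2e1e2 teq_e1e2x1 teq_x2e1x2.
expand lin_e1x2x1 at d [::] 0 0 [::].
expand lin_x2x1e2 at d [::] 0 0 [::].
expand lin_vtx_vtx at d [::] 0 1 [::].
expand lin_vtx_vtx at d [::] 1 0 [::].
expand lin_vtx_cap at d [::] 1 0 [:: cup 1].
expand lin_vtx_cup at d [:: cap 0] 0 1 [::].
(* So far x1 and x2 have coefficient p^2 - p(p + q), and e1x2 and x1e2 have q^2 - q(p + q): all
   equal -AB. *)
expand lin_G4 at d [::] 0 0 [::].
by rewrite c_xiE; case: o; rewrite /coef_vert /coef_horiz; ring.
Qed.

Lemma teq_move2' o : teq 2 2 [:: nd (Crossing (~~ o)) 0; nd (Crossing o) 0] [::].
Proof. by have := teq_move2 (~~ o); rewrite negbK. Qed.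

Lemma teq_move4' o :
  teq 3 3 [:: vtx 0; nd (Crossing o) 1; nd (Crossing o) 0]
          [:: nd (Crossing o) 1; nd (Crossing o) 0; vtx 1].
Proof.
set s := nd (Crossing o); set t := nd (Crossing (~~ o)).
(* Inverse crossings inserted below the vertex allow [teq_move4] for the opposite crossing; once
   above the vertex they cancel with the original ones. *)
via [:: s 1; t 1; vtx 0; s 1; s 0] by (teq_sym (teq_move2 o))
  at [::] 1 0 [:: vtx 0; s 1; s 0].
via [:: s 1; s 0; t 0; t 1; vtx 0; s 1; s 0] by (teq_sym (teq_move2 o))
  at [:: s 1] 0 1 [:: t 1; vtx 0; s 1; s 0].
via [:: s 1; s 0; vtx 1; t 0; t 1; s 1; s 0] by (teq_sym (teq_move4 (~~ o)))
  at [:: s 1; s 0] 0 0 [:: s 1; s 0].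
via [:: s 1; s 0; vtx 1; t 0; s 0] by (teq_move2' o)
  at [:: s 1; s 0; vtx 1; t 0] 1 0 [:: s 0].
by via [:: s 1; s 0; vtx 1] by (teq_move2' o) at [:: s 1; s 0; vtx 1] 0 1 [::].
Qed.

Lemma teq_cap_slide' x : teq 3 1 [:: nd x 1; cap 0] [:: nd (quarter_turn x) 0; cap 1].
Proof.
by apply: teq_sym; have := teq_cap_slide (quarter_turn x); rewrite quarter_turnK.
Qed.

Lemma teq_cup_slide' x : teq 1 3 [:: cup 0; nd (quarter_turn x) 1] [:: cup 1; nd x 0].
Proof.
by apply: teq_sym; have := teq_cup_slide (quarter_turn x); rewrite quarter_turnK.
Qed.

(** Sliding the second crossing along the maximum makes it inverse to the first: (II) pulls the
    strand off the maximum, and then across the minimum. *)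
Lemma teq_crossings_cap o :
  teq 3 3 [:: nd (Crossing o) 0; nd (Crossing o) 1; cap 0; cup 0]
          [:: cap 1; cup 1; nd (Crossing o) 0; nd (Crossing o) 1].
Proof.
set s := nd (Crossing o); set t := nd (Crossing (~~ o)).
via [:: s 0; t 0; cap 1; cup 0] by (teq_cap_slide' (Crossing o))
  at [:: s 0] 0 0 [:: cup 0].
via [:: cap 1; cup 0] by (teq_move2 o) at [::] 0 1 [:: cap 1; cup 0].
via [:: cap 1; cup 0; t 1; s 1] by (teq_sym (teq_move2' o))
  at [:: cap 1; cup 0] 1 0 [::].
by via [:: cap 1; cup 1; s 0; s 1] by (teq_cup_slide' (Crossing o))
  at [:: cap 1] 0 0 [:: s 1].
Qed.

Lemma teq_crossings_cap' o :
  teq 3 3 [:: cap 0; cup 0; nd (Crossing o) 1; nd (Crossing o) 0]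
          [:: nd (Crossing o) 1; nd (Crossing o) 0; cap 1; cup 1].
Proof.
set s := nd (Crossing o); set t := nd (Crossing (~~ o)).
via [:: cap 0; cup 1; t 0; s 0] by (teq_sym (teq_cup_slide (Crossing o)))
  at [:: cap 0] 0 0 [:: s 0].
via [:: cap 0; cup 1] by (teq_move2' o) at [:: cap 0; cup 1] 0 1 [::].
via [:: s 1; t 1; cap 0; cup 1] by (teq_sym (teq_move2 o))
  at [::] 1 0 [:: cap 0; cup 1].
by via [:: s 1; s 0; cap 1; cup 1] by (teq_sym (teq_cap_slide (Crossing o)))
  at [:: s 1] 0 0 [:: cup 1].
Qed.

Lemma teq_move3 c01 c02 c12 : layered c01 c02 c12 ->
  teq 3 3 [:: nd (Crossing c01) 0; nd (Crossing c02) 1; nd (Crossing c12) 0]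
          [:: nd (Crossing c12) 1; nd (Crossing c02) 0; nd (Crossing c01) 1].
Proof.
(* Either strand 0 is over or under both others and the crossing of 1 and 2 is expanded, or strand 2
   is and that of 0 and 1 is expanded. *)
case/orP => /eqP->; [set o := c02; set c := c12 | set o := c12; set c := c01] => d.
  expand (lin_skein c) at d [:: nd (Crossing o) 0; nd (Crossing o) 1] 0 1 [::].
  expand (lin_skein c) at d [::] 1 0 [:: nd (Crossing o) 0; nd (Crossing o) 1].
  by rewrite (teq_crossings_cap o) (teq_move4 o).
expand (lin_skein c) at d [::] 0 1 [:: nd (Crossing o) 1; nd (Crossing o) 0].
expand (lin_skein c) at d [:: nd (Crossing o) 1; nd (Crossing o) 0] 1 0 [::].
by rewrite (teq_crossings_cap' o) (teq_move4' o).
Qed.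

Lemma teq_crossing_vtx o :
  teq 2 2 [:: nd (Crossing o) 0; vtx 0] [:: vtx 0; nd (Crossing o) 0].
Proof.
move=> d; expand (lin_skein o) at d [::] 0 0 [:: vtx 0].
expand (lin_skein o) at d [:: vtx 0] 0 0 [::].
expand lin_vtx_cup at d [:: cap 0] 0 0 [::].
by expand lin_vtx_cap at d [::] 0 0 [:: cup 0].
Qed.

Lemma teq_move5 o :
  teq 2 2 [:: nd (Crossing o) 0; vtx 0; nd (Crossing (~~ o)) 0] [:: vtx 0].
Proof.
via [:: vtx 0; nd (Crossing o) 0; nd (Crossing (~~ o)) 0] by (teq_crossing_vtx o)
  at [::] 0 0 [:: nd (Crossing (~~ o)) 0].
by via [:: vtx 0] by (teq_move2 o) at [:: vtx 0] 0 0 [::].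
Qed.

Lemma br_regular D D' : regular_isotopy D D' -> br D = br D'.
Proof.
elim=> {D D'} [D D'|//|D D' _ -> //|D D' D'' _ -> _ -> //].
case=> {D D'} [D D' DD'|o d|c01 c02 c12 d layered_c|o d|o d].
- exact/br_planar/rst_step.
- by rewrite -!value_plug; apply: teq_move2.
- by rewrite -!value_plug; apply: teq_move3.
- by rewrite -!value_plug; apply: teq_move4.
- by rewrite -!value_plug; apply: teq_move5.
Qed.

(** * Curls *)

Lemma teq_curl_horizontal s :
  teq 1 1 (if s then [:: cup 1; cap 0; cup 0; cap 1]
           else [:: cup 0; cap 1; cup 1; cap 0]) [::].
Proof.
case: s; [via [:: cup 0; cap 1] by teq_zigzag_right at [::] 0 0 [:: cup 0; cap 1]
         |via [:: cup 1; cap 0] by teq_zigzag_left at [::] 0 0 [:: cup 1; cap 0]].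
  exact: teq_zigzag_left.
exact: teq_zigzag_right.
Qed.

Lemma br_curl o s (d : outside 1 1) :
  br (plug d (looped (Crossing o) s)) =
    ((coef_vert o * c_mu + coef_horiz o + c_O) * br (plug d strand))%R.
Proof.
rewrite -!value_plug; case: s => /=.
  expand (lin_skein o) at d [:: cup 1] 0 1 [:: cap 1].
  expand (lin_circle true) at d [::] 0 0 [::].
  expand (lin_loop true) at d [::] 0 0 [::].
  by rewrite (teq_curl_horizontal true); ring.
expand (lin_skein o) at d [:: cup 0] 1 0 [:: cap 0].
expand (lin_circle false) at d [::] 0 0 [::].
expand (lin_loop false) at d [::] 0 0 [::].
by rewrite (teq_curl_horizontal false); ring.
Qed.

End Bracket.

Local Open Scope ring_scope.

Theorem proposition8 (br : diagram -> K)
    (br_planar : forall D D' : diagram, planar_isotopy D D' -> br D = br D')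
    (br_calculus : graphical_calculus br)
    (br_skein : skein_relation br) :
  (forall D D' : diagram, regular_isotopy D D' -> br D = br D') /\
  (forall (d : outside 1 1) (on_right : bool),
     br (plug d (positive_curl on_right)) = va * br (plug d strand)) /\
  (forall (d : outside 1 1) (on_right : bool),
     br (plug d (negative_curl on_right)) = va^-1 * br (plug d strand)).
Proof.
split; first exact: br_regular.
split=> d on_right; rewrite /positive_curl /negative_curl br_curl //.
  by rewrite positive_curl_factor.
by rewrite negative_curl_factor.
Qed.
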